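(* Let $n\geq 10$ be an integer with $n\equiv 1\pmod 3$, let $E=E(W_n)$ be the eccentricity matrix of the wheel graph $W_n$, and let $\mathbf{w}=\frac{1}{6}(7-n,1,\dots,1)'\in\mathbb{R}^n$. Let $\hat{L}$ be the $n\times n$ matrix $$\hat{L}=\frac{n-1}{3}I_n-\frac13\begin{bmatrix}0&\mathbf{e}'\\ \mathbf{e}&\mathbf{0}\end{bmatrix}+\begin{bmatrix}0&\mathbf{0}'\\ \mathbf{0}&P\end{bmatrix},$$ where $P$ is the $(n-1)\times(n-1)$ circulant matrix defined in the context. Then the Moore-Penrose inverse $E^{\dagger}$ of $E$ is $$E^{\dagger}=-\frac12\hat{L}+\frac{6}{n-1}\mathbf{w}\mathbf{w}'.$$
   Context: The prime denotes transpose, $I_n$ is the identity matrix, and $\mathbf{e}$ denotes the all-ones column vector (here in $\mathbb{R}^{n-1}$). In the block matrices the blocks have sizes $1$ and $n-1$. For a vector $\mathbf{c}=(c_1,\dots,c_m)'$, $\operatorname{Circ}(\mathbf{c}')$ is the $m\times m$ circulant matrix with first row $(c_1,\dots,c_m)$ and each subsequent row the cyclic right shift by one of the previous row. Definition of $P$ (for $n\equiv 1\pmod 3$, $n\ge 10$). Let $\mathbf{e_i}$ be the $i$-th standard basis vector of $\mathbb{R}^{n-1}$ and $\mathbf{c_k}=\mathbf{e_{k+1}}+\mathbf{e_{n-k}}\in\mathbb{R}^{n-1}$, for $1\le k\le \frac{n-2}{2}$ if $n$ is even and $1\le k\le\frac{n-3}{2}$ if $n$ is odd. If $n$ is even, $P=\frac{1}{3(n-1)}\operatorname{Circ}(\mathbf{z_1}')$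 with $$\mathbf{z_1}=(2n-n^2)\mathbf{e_1}+\sum_{k=1}^{\frac{n-4}{6}}\left(\frac{3n-18k+8}{2}\mathbf{c_{3k-2}}-\frac{3n-18k+4}{2}\mathbf{c_{3k-1}}+\mathbf{c_{3k}}\right)+\mathbf{c_{\frac n2-1}}.$$ If $n$ is odd, $P=\frac{1}{3(n-1)}\operatorname{Circ}(\mathbf{z_2}')$ with $$\mathbf{z_2}=(2n-n^2)\mathbf{e_1}+\sum_{k=1}^{\frac{n-1}{6}}\left(\frac{3n-18k+8}{2}\mathbf{c_{3k-2}}-\frac{3n-18k+4}{2}\mathbf{c_{3k-1}}\right)+\sum_{k=1}^{\frac{n-7}{6}}\mathbf{c_{3k}}+\mathbf{e_{\frac{n+1}{2}}}.$$ The Moore-Penrose inverse of a real $m\times n$ matrix $A$ is the unique $n\times m$ matrix $X=A^{\dagger}$ with $AXA=A$, $XAX=X$, $(AX)'=AX$, $(XA)'=XA$. For a simple connected graph $G$ with vertices $v_1,\dots,v_n$, let $d(v_i,v_j)$ be the length of a shortest path between $v_i$ and $v_j$, and let $e(v_i)=\max\{d(v_i,v_j):1\le j\le n\}$. The eccentricity matrix $E(G)$ is the $n\times n$ real matrix with $(E(G))_{ij}=d(v_i,v_j)$ if $d(v_i,v_j)=\min\{e(v_i),e(v_j)\}$, and $(E(G))_{ij}=0$ otherwise. The wheel graph $W_n$ is the graph on $n$ vertices consisting of a cycle of length $n-1$ together with one further vertex (the hub) adjacent to every vertex of the cycle. The vertices are labelled so that $v_1$ is the hub and $v_2,\dots,v_n$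 are the cycle vertices in cyclic order. *)

(* Defs.v *)
(* Mathematical Components; the field of real numbers is an [R : realType]. *)
From HB Require Import structures.
From mathcomp Require Import all_boot all_order all_algebra.
From mathcomp Require Import reals.

Set Implicit Arguments.
Unset Strict Implicit.
Unset Printing Implicit Defensive.

Import Order.TTheory GRing.Theory Num.Theory.
Local Open Scope ring_scope.

Section MoorePenrose.
Variable R : realType.

Definition penrose m n (A : 'M[R]_(m, n)) (X : 'M[R]_(n, m)) : bool :=
  [&& A *m X *m A == A, X *m A *m X == X,
      (A *m X)^T == A *m X & (X *m A)^T == X *m A].

Lemma penrose_unique m n (A : 'M[R]_(m, n)) (X Y : 'M[R]_(n, m)) :
  penrose A X -> penrose A Y -> X = Y.
Proof.
move=> /and4P[/eqP X1 /eqP X2 /eqP X3 /eqP X4].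
move=> /and4P[/eqP Y1 /eqP Y2 /eqP Y3 /eqP Y4].
have AXY : A *m X = A *m Y.
  rewrite -[LHS]X3 -{1}Y1 -(mulmxA (A *m Y)) trmx_mul X3 Y3.
  by rewrite mulmxA X1.
have XYA : X *m A = Y *m A.
  rewrite -[LHS]X4 -{1}Y1 -(mulmxA A Y A) mulmxA trmx_mul X4 Y4.
  by rewrite -mulmxA (mulmxA A) X1.
by rewrite -X2 XYA -mulmxA AXY mulmxA Y2.
Qed.

Lemma gram_unit m n (B : 'M[R]_(m, n)) : row_free B -> B *m B^T \in unitmx.
Proof.
move=> fB; rewrite -row_free_unit -kermx_eq0; apply/rowV0P => v /sub_kermxP.
move=> vBB; apply: (row_free_inj fB); rewrite mul0mx.
have /matrixP/(_ 0 0) : (v *m B) *m (v *m B)^T = 0.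
  by rewrite trmx_mul mulmxA -(mulmxA v) vBB mul0mx.
rewrite !mxE => /psumr_eq0P s0; apply/rowP => j; rewrite [RHS]mxE.
apply/eqP; rewrite -sqrf_eq0 expr2; apply/eqP.
have := s0 _ j; rewrite [X in _ * X]mxE; apply=> // k _.
by rewrite [X in _ * X]mxE -expr2 sqr_ge0.
Qed.

Lemma penrose_exists m n (A : 'M[R]_(m, n)) : exists X, penrose A X.
Proof.
set B := row_base A; set C := col_base A.
have uB : B *m B^T \in unitmx by apply: gram_unit; apply: row_base_free.
have uC : C^T *m C \in unitmx.
  rewrite -{2}[C]trmxK; apply: gram_unit.
  by rewrite /row_free mxrank_tr; apply: col_base_full.
have -> : A = C *m B by rewrite mulmx_base.
move: B C uB uC; set r := \rank A => B C uB uC.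
exists (B^T *m invmx (B *m B^T) *m (invmx (C^T *m C) *m C^T)).
set Bi := B^T *m _; set Ci := _ *m C^T.
have BK : B *m Bi = 1%:M by rewrite mulmxA mulmxV.
have CK : Ci *m C = 1%:M by rewrite -mulmxA mulVmx.
have AX : C *m B *m (Bi *m Ci) = C *m Ci.
  by rewrite mulmxA -(mulmxA C) BK mulmx1.
have XA : Bi *m Ci *m (C *m B) = Bi *m B.
  by rewrite mulmxA -(mulmxA Bi) CK mulmx1.
apply/and4P; split; apply/eqP.
- by rewrite AX mulmxA -(mulmxA C) CK mulmx1.
- by rewrite XA mulmxA -(mulmxA Bi) BK mulmx1.
- rewrite AX /Ci !trmx_mul trmxK trmx_inv trmx_mul trmxK.
  by rewrite !mulmxA.
- rewrite XA /Bi !trmx_mul trmxK trmx_inv trmx_mul trmxK.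
  by rewrite !mulmxA.
Qed.

Definition mpinv m n (A : 'M[R]_(m, n)) : 'M[R]_(n, m) :=
  xchoose (penrose_exists A).

Lemma mpinvP m n (A : 'M[R]_(m, n)) : penrose A (mpinv A).
Proof. exact: xchooseP. Qed.

Lemma mpinv_eq m n (A : 'M[R]_(m, n)) (X : 'M[R]_(n, m)) :
  penrose A X -> mpinv A = X.
Proof. exact/penrose_unique/mpinvP. Qed.

End MoorePenrose.

Record connected_graph (V : finType) := ConnectedGraph {
  edge :> rel V;
  edge_sym : symmetric edge;
  edge_irrefl : irreflexive edge;
  edge_connected : forall x y, connect edge x y
}.

Section Eccentricity.
Variables (V : finType) (G : connected_graph V).

Definition has_path_of_length (x y : V) (k : nat) : bool :=
  [exists p : k.-tuple V,
     [&& path (edge G) x p, uniq (x :: p) & last x p == y]].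

Lemma path_exists (x y : V) : exists k, has_path_of_length x y k.
Proof.
have /connectP[p0 p0P ->] := edge_connected G x y.
case: (shortenP p0P) => p pP p_uniq _.
by exists (size p); apply/existsP; exists (in_tuple p); apply/and3P.
Qed.

Definition dist (x y : V) : nat := ex_minn (path_exists x y).

Definition ecc (x : V) : nat := \max_y dist x y.

End Eccentricity.

Definition ecc_mx (R : realType) n (G : connected_graph 'I_n) : 'M[R]_n :=
  \matrix_(i, j)
    (if dist G i j == minn (ecc G i) (ecc G j) then (dist G i j)%:R else 0).

(* The n vertices of W_n are indexed by 'I_(1 + n.-1), matching the blocks of
   sizes 1 and n - 1; the left summand is the hub, the right one the cycle in
   cyclic order.  The conjunct [i != j] is redundant for n >= 3; it only rules
   out a loop at the single rim vertex when n = 2. *)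
Definition wheel_edge n : rel 'I_(1 + n.-1) := fun x y =>
  match split x, split y with
  | inl _, inl _ => false
  | inl _, inr _ | inr _, inl _ => true
  | inr i, inr j => (i != j) && ((j == ordS i) || (i == ordS j))
  end.

Lemma wheel_sym n : symmetric (@wheel_edge n).
Proof.
move=> x y; rewrite /wheel_edge; case: split => i; case: split => j //.
by rewrite eq_sym orbC.
Qed.

Lemma wheel_irrefl n : irreflexive (@wheel_edge n).
Proof. by move=> x; rewrite /wheel_edge; case: split => i //; rewrite eqxx. Qed.

Lemma wheel_connected n (x y : 'I_(1 + n.-1)) : connect (@wheel_edge n) x y.
Proof.
have hub z : connect (@wheel_edge n) (lshift n.-1 ord0) z.
  case: (split_ordP z) => i ->; first by rewrite (ord1 i) connect0.
  apply: connect1; rewrite /wheel_edge.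
  by rewrite -[lshift _ _]/(unsplit (inl _)) -[rshift _ _]/(unsplit (inr _)) !unsplitK.
apply: connect_trans (hub y).
by rewrite (sym_connect_sym (@wheel_sym n)).
Qed.

Definition wheel n : connected_graph 'I_(1 + n.-1) :=
  ConnectedGraph (@wheel_sym n) (@wheel_irrefl n) (@wheel_connected n).

Section LHat.
Variable R : realType.

Definition shift_right m (c : 'rV[R]_m) : 'rV[R]_m :=
  \row_j c 0 (ord_pred j).

Definition Circ m (c : 'rV[R]_m) : 'M[R]_m :=
  \matrix_(i < m) iter i (@shift_right m) c.

Variable n : nat.

(* Standard basis vectors of R^(n-1), with indices starting at 1. *)
Definition std_basis (i : nat) : 'cV[R]_n.-1 := \col_j (j.+1 == i)%:R.

Definition cvec (k : nat) : 'cV[R]_n.-1 := std_basis k.+1 + std_basis (n - k).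

Definition zcoef1 (k : nat) : R := (3 * n%:R - 18 * k%:R + 8) / 2.
Definition zcoef2 (k : nat) : R := (3 * n%:R - 18 * k%:R + 4) / 2.

(* Under n = 1 mod 3, every quotient [%/] below is exact in the parity case
   where it is used. *)
Definition z1 : 'cV[R]_n.-1 :=
  (2 * n%:R - n%:R ^+ 2) *: std_basis 1
  + \sum_(1 <= k < ((n - 4) %/ 6).+1)
      (zcoef1 k *: cvec (3 * k - 2) - zcoef2 k *: cvec (3 * k - 1)
       + cvec (3 * k))
  + cvec (n %/ 2 - 1).

Definition z2 : 'cV[R]_n.-1 :=
  (2 * n%:R - n%:R ^+ 2) *: std_basis 1
  + \sum_(1 <= k < ((n - 1) %/ 6).+1)
      (zcoef1 k *: cvec (3 * k - 2) - zcoef2 k *: cvec (3 * k - 1))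
  + \sum_(1 <= k < ((n - 7) %/ 6).+1) cvec (3 * k)
  + std_basis (n.+1 %/ 2).

Definition Pmx : 'M[R]_n.-1 :=
  (1 / (3 * (n%:R - 1))) *: Circ (if odd n then z2 else z1)^T.

Definition Lhat : 'M[R]_(1 + n.-1) :=
  ((n%:R - 1) / 3) *: 1%:M
  - (1 / 3) *: block_mx 0 (const_mx 1) (const_mx 1) 0
  + block_mx 0 0 0 Pmx.

Definition wvec : 'cV[R]_(1 + n.-1) :=
  (1 / 6) *: col_mx (const_mx (7 - n%:R)) (const_mx 1).

End LHat.

(* Main.v *)
(** Write m = n - 1, J for the all-ones matrix, B for the circulant matrix of
    closed neighbourhoods in the rim, and K for the matrix with entries
    [3 | j - i].  Then E is the block matrix [[0, e'], [e, 2(J - B)]], and the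
    claimed inverse turns out to be X = [[6/m - 2, e'/m], [e/m, Y/(4m)]] with Y
    the circulant matrix whose first row is d |-> 0, 2d + 1 - m, m + 1 - 2d
    according to d mod 3.  Since 3 divides m, the identities
    B Y = 6 K - 2 m I, B K = J and K Y = 0 hold, and they give
    E X = X E = diag(1, I + J/m - 3 K/m), a symmetric idempotent fixing E and X. *)
Require Import Defs.
From mathcomp Require Import all_boot all_order all_algebra.
From mathcomp Require Import reals.
From mathcomp Require Import zify ring.

Import Order.TTheory GRing.Theory Num.Theory.
Local Open Scope ring_scope.

(** * Distances 0, 1 and 2 in a connected graph *)

Section GraphDistance.
Context {V : finType}.
Variable G : connected_graph V.

Lemma dist_le x y k : has_path_of_length G x y k -> (dist G x y <= k)%N.
Proof. by rewrite /dist; case: ex_minnP => d _ dmin /dmin. Qed.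

Lemma dist_path x y : has_path_of_length G x y (dist G x y).
Proof. by rewrite /dist; case: ex_minnP. Qed.

Lemma dist_refl x : dist G x x = 0%N.
Proof.
apply/eqP; rewrite -leqn0; apply: dist_le.
by apply/existsP; exists [tuple]; rewrite /= eqxx.
Qed.

Lemma dist_gt0 x y : x != y -> (0 < dist G x y)%N.
Proof.
rewrite lt0n; apply: contra => /eqP d0; have := dist_path x y; rewrite d0.
by case/existsP=> p; rewrite tuple0 /=.
Qed.

Lemma dist_edge {x y} : edge G x y -> dist G x y = 1%N.
Proof.
move=> xy; have x_neq_y : x != y.
  by apply/eqP => eq_xy; move: xy; rewrite eq_xy edge_irrefl.
apply/eqP; rewrite eqn_leq dist_gt0 // andbT; apply: dist_le.
by apply/existsP; exists [tuple y]; rewrite /= xy inE x_neq_y eqxx.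
Qed.

Lemma dist_common_neighbour {x y} z :
  x != y -> ~~ edge G x y -> edge G x z -> edge G z y -> dist G x y = 2.
Proof.
move=> x_neq_y xNy xz zy; apply/eqP; rewrite eqn_leq; apply/andP; split.
  apply: dist_le; apply/existsP; exists [tuple z; y]; rewrite /= xz zy !inE.
  rewrite negb_or x_neq_y eqxx !andbT /=.
  by apply/andP; split; apply/eqP => eq_z; move: xz zy; rewrite eq_z edge_irrefl.
rewrite ltn_neqAle dist_gt0 // andbT; apply/eqP => d1; move: (dist_path x y).
rewrite -d1; case/existsP=> p; case/tupleP: p => u p; rewrite tuple0 /=.
by rewrite andbT => /and3P[xu _ /eqP uy]; rewrite -uy xu in xNy.
Qed.

End GraphDistance.

(** * Circulant matrices indexed by the ring of integers modulo [m.+2] *)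

Section Circulant.
Context {R : realType} {m : nat}.

Lemma val_ordrN1 : val (-1 : 'I_m.+2) = m.+1.
Proof. by rewrite /= !modn_small. Qed.

Lemma ordS_addr1 (i : 'I_m.+2) : ordS i = i + 1.
Proof. by apply: val_inj; rewrite /= modnDmr addn1. Qed.

Lemma ord_pred_subr1 (i : 'I_m.+2) : ord_pred i = i - 1.
Proof. by rewrite -[i in LHS](subrK 1) -ordS_addr1 ordSK. Qed.

(** The difference is taken in the cyclic group, so products become convolutions and transposition
    becomes negation of the argument. *)
Definition circulant (f : 'I_m.+2 -> R) : 'M[R]_m.+2 :=
  \matrix_(i, j) f (j - i).

Definition closed_nbhd_mx : 'M[R]_m.+2 :=
  circulant (fun d => [|| d == 0, d == 1 | d == -1]%:R).

Lemma trmx_circulant f : (forall d, f (- d) = f d) -> (circulant f)^T = circulant f.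
Proof. by move=> f_even; apply/matrixP => i j; rewrite !mxE -f_even opprB. Qed.

Lemma mul_circulant f g :
  circulant f *m circulant g = circulant (fun d => \sum_k f k * g (d - k)).
Proof.
apply/matrixP => i j; rewrite !mxE (reindex_inj (addrI i)); apply: eq_bigr => k _.
by rewrite !mxE [i + k]addrC addrK opprD addrAC addrA.
Qed.

Lemma mul_circulant_const f p (a : R) :
  circulant f *m const_mx a = const_mx ((\sum_d f d) * a) :> 'M_(_, p).
Proof.
apply/matrixP => i j; rewrite !mxE mulr_suml (reindex_inj (addrI i)).
by apply: eq_bigr => k _; rewrite !mxE [i + k]addrC addrK.
Qed.

Lemma Circ_circulant (c : 'rV[R]_m.+2) : Circ c = circulant (c 0).
Proof.
(* Writing [i] as a sum of ones allows induction on the number of shifts, each of which subtracts 1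
   from the column index. *)
apply/matrixP => i j; rewrite !mxE -[in RHS](natr_Zp i).
elim: (val i) j => [|k IHk] j.
  by rewrite subr0.
by rewrite iterS mxE IHk ord_pred_subr1 -natr1 opprD addrA addrAC.
Qed.

End Circulant.

(** * The eccentricity matrix of the wheel with [m.+2] rim vertices *)

Section WheelEccentricity.
Context {R : realType} {m : nat}.
Hypothesis m_ge2 : (2 <= m)%N.
Local Notation G := (wheel m.+3).
Local Notation hub := (lshift m.+2 (ord0 : 'I_1)).
Local Notation rim i := (rshift 1 (i : 'I_m.+2)).

Lemma split_hub : split hub = inl ord0.
Proof. exact: (unsplitK (inl _)). Qed.

Lemma split_rim (i : 'I_m.+2) : split (rim i) = inr i.
Proof. exact: (unsplitK (inr _)). Qed.

Lemma edge_hub_rim (i : 'I_m.+2) : edge G hub (rim i).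
Proof. by rewrite /= /wheel_edge split_hub split_rim. Qed.

Lemma edge_rim_hub (i : 'I_m.+2) : edge G (rim i) hub.
Proof. by rewrite /= /wheel_edge split_hub split_rim. Qed.

Lemma edge_rim (i j : 'I_m.+2) :
  edge G (rim i) (rim j) = (j - i == 1) || (j - i == -1).
Proof.
rewrite /= /wheel_edge !split_rim !ordS_addr1.
rewrite !subr_eq (addrC 1 i) (addrC (-1) i) -(subr_eq i j 1) [i - 1 == j]eq_sym.
(* For [i = j] both sides are false, the right one because 1 and -1 are nonzero. *)
case: (eqVneq i j) => [->|//] /=; rewrite -![j == j + _]subr_eq0 !opprD !addNKr.
by rewrite opprK oppr_eq0 oner_eq0.
Qed.

(** The hub is a common neighbour of all rim vertices, so no rim distance exceeds 2. *)
Lemma dist_rim (i j : 'I_m.+2) :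
  dist G (rim i) (rim j) =
    if j - i == 0 then 0%N
    else if (j - i == 1) || (j - i == -1) then 1%N else 2.
Proof.
rewrite subr_eq0; case: eqVneq => [->|j_neq_i]; first exact: dist_refl.
case: ifPn => [|ij]; first by rewrite -edge_rim; apply: dist_edge.
apply: (dist_common_neighbour G hub); rewrite ?edge_rim_hub ?edge_hub_rim //.
  by rewrite (inj_eq (@rshift_inj _ _)) eq_sym.
by rewrite edge_rim.
Qed.

Lemma ecc_hub : ecc G hub = 1%N.
Proof.
apply/eqP; rewrite eqn_leq; apply/andP; split.
  apply/bigmax_leqP => x _; case: (split_ordP x) => i ->.
    by rewrite (ord1 i) dist_refl.
  by rewrite (dist_edge G (edge_hub_rim i)).
apply: leq_trans (leq_bigmax (rim 0)).
by rewrite (dist_edge G (edge_hub_rim 0)).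
Qed.

Lemma ecc_rim (i : 'I_m.+2) : ecc G (rim i) = 2.
Proof.
apply/eqP; rewrite eqn_leq; apply/andP; split.
  apply/bigmax_leqP => x _; case: (split_ordP x) => j ->.
    by rewrite (ord1 j) (dist_edge G (edge_rim_hub i)).
  by rewrite dist_rim; do !case: ifP.
(* The rim has at least four vertices, so 2 differs from 0, 1 and -1, and the rim vertex [i + 2] is
   at distance 2 from [i]. *)
pose d : 'I_m.+2 := Ordinal (ltnW m_ge2 : 2 < m.+2)%N.
apply: leq_trans (leq_bigmax (rim (i + d))).
rewrite dist_rim [i + d]addrC addrK -!(inj_eq val_inj) val_ordrN1 /=.
by rewrite eqSS; case: eqP m_ge2 => // <-.
Qed.

(** Two rim vertices both have eccentricity 2, so only pairs at distance 2 survive, namely those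
    outside B. Between hub and rim the minimum is 1, which is the distance. *)
Lemma ecc_mx_wheel :
  ecc_mx R G =
    block_mx 0 (const_mx 1) (const_mx 1) (2 *: (const_mx 1 - closed_nbhd_mx)).
Proof.
apply/matrixP => x y; case: (split_ordP x) => i ->; case: (split_ordP y) => j ->.
- by rewrite (ord1 i) (ord1 j) block_mxEul !mxE dist_refl ecc_hub.
- by rewrite (ord1 i) block_mxEur !mxE ecc_hub ecc_rim (dist_edge G (edge_hub_rim j)).
- by rewrite (ord1 j) block_mxEdl !mxE ecc_hub ecc_rim (dist_edge G (edge_rim_hub i)).
rewrite block_mxEdr !mxE !ecc_rim dist_rim minnn.
case: (j - i == 0) => /=; first by rewrite subrr mulr0.
by case: orP => _ /=; rewrite ?subrr ?mulr0 ?subr0 ?mulr1.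
Qed.

End WheelEccentricity.

(** * The first row of Y, according to residues modulo 3 *)

Section FirstRow.
Context {R : realType}.

(** Here [m] is the rim length and [d] the representative in [0, m). The formula is not periodic in
    [d], so wrap-around is treated separately. *)
Definition yrow (m d : nat) : R :=
  match (d %% 3)%N with
  | 1 => 2 * d%:R + 1 - m%:R
  | 2 => m%:R + 1 - 2 * d%:R
  | _ => 0
  end.

Lemma yrow0 m a : yrow m (3 * a) = 0.
Proof. by rewrite /yrow modnMr. Qed.

Lemma yrow1 m a : yrow m (3 * a).+1 = 6 * a%:R + 3 - m%:R.
Proof. by rewrite /yrow -addn1 mulnC modnMDl natrD natrM; ring. Qed.

Lemma yrow2 m a : yrow m (3 * a).+2 = m%:R - 3 - 6 * a%:R.
Proof. by rewrite /yrow -addn2 mulnC modnMDl natrD natrM; ring. Qed.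

Definition yrowE := (yrow0, yrow1, yrow2).

Variant mod3_spec : nat -> Type :=
  | Mod3_0 a : mod3_spec (3 * a)
  | Mod3_1 a : mod3_spec (3 * a).+1
  | Mod3_2 a : mod3_spec (3 * a).+2.

Lemma mod3P d : mod3_spec d.
Proof.
rewrite (divn_eq d 3) mulnC.
case: (d %% 3)%N (ltn_pmod d (isT : 0 < 3)%N) => [|[|[|]]] // _.
- by rewrite addn0; constructor.
- by rewrite addn1; constructor.
- by rewrite addn2; constructor.
Qed.

(** Reflection exchanges the residues 1 and 2, and with them the two linear branches. This makes Y
    symmetric. *)
Lemma yrow_opp t d : (0 < d <= 3 * t)%N -> yrow (3 * t) (3 * t - d) = yrow (3 * t) d.
Proof.
case: (mod3P d) => a /andP[_ le_d].
- by rewrite -mulnBr !yrowE.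
- have [-> lt_at] : (3 * t - (3 * a).+1)%N = (3 * (t - a.+1)).+2 /\ (a < t)%N by lia.
  by rewrite !yrowE natrB // natrM -natr1; ring.
- have [-> lt_at] : (3 * t - (3 * a).+2)%N = (3 * (t - a.+1)).+1 /\ (a < t)%N by lia.
  by rewrite !yrowE natrB // natrM -natr1; ring.
Qed.

(** The values at 3a + 1 and 3a + 2 cancel, while those at 3a - 1 and 3a + 1 add up to 6. The bounds
    on [d] are the range in which neither neighbour wraps around. *)
Lemma yrow_nbhd t d : (0 < d < (3 * t).-1)%N ->
  yrow (3 * t) d + yrow (3 * t) d.-1 + yrow (3 * t) d.+1 = 6 * (3 %| d)%:R.
Proof.
case: (mod3P d) => a /andP[d_gt0 lt_d].
- case: a d_gt0 lt_d => // a _ lt_d.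
  rewrite dvdn_mulr // yrow0 yrow1.
  by rewrite mulnS /= yrow2 -natr1 natrM; ring.
- have -> : (3 %| (3 * a).+1)%N = false by lia.
  by rewrite /= !yrowE; ring.
- have -> : (3 * a).+3 = (3 * a.+1)%N by lia.
  have -> : (3 %| (3 * a).+2)%N = false by lia.
  by rewrite /= !yrowE; ring.
Qed.

(** Keeping [m] independent of [t] permits induction on [t]; the sum vanishes at [m = 3 * t], which
    yields K Y = 0. *)
Lemma sum_yrow_class m t r : (r < 3)%N ->
  \sum_(0 <= d < 3 * t) (d %% 3 == r)%N%:R * yrow m d =
    t%:R * (3 * t%:R - m%:R) * ((r == 1)%N%:R - (r == 2)%N%:R).
Proof.
move=> lt_r3; elim: t => [|t IHt]; first by rewrite muln0 big_geq // !mul0r.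
have -> : (3 * t.+1)%N = (3 * t).+3 by lia.
rewrite !big_nat_recr //= IHt !yrowE.
have -> : (3 * t %% 3 = 0)%N by lia.
have -> : ((3 * t).+1 %% 3 = 1)%N by lia.
have -> : ((3 * t).+2 %% 3 = 2)%N by lia.
by case: r lt_r3 {IHt} => [|[|[|]]] //= _; rewrite -natr1; ring.
Qed.

(** * Entries of the vectors [z1] and [z2] *)

Lemma sum_delta a b k0 (F : nat -> R) :
  \sum_(a <= k < b) F k * (k == k0)%:R = if (a <= k0 < b)%N then F k0 else 0.
Proof.
case: ifPn => k0_in; last first.
  rewrite big_nat big1 // => k k_in.
  by rewrite (_ : (k == k0) = false) ?mulr0 //; apply: contraNF k0_in => /eqP <-.
rewrite (bigD1_seq k0) ?mem_index_iota ?iota_uniq //= eqxx mulr1.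
by rewrite big1 ?addr0 // => k /negPf->; rewrite mulr0.
Qed.

(** The two index tests are passed as booleans so that their values can be settled by [lia]. *)
Lemma cvec_entry n k (d : 'I_n.-1) (b b' : bool) :
  (d.+1 == k.+1) = b -> (d.+1 == n - k)%N = b' -> cvec R n k d 0 = b%:R + b'%:R.
Proof. by move=> <- <-; rewrite !mxE. Qed.

Section Cvec.
Context {t : nat} (k : nat) (d : 'I_(3 * t).+1.-1) (a : nat).
Hypothesis k_in : (0 < k <= t)%N.
Local Notation c i := (cvec R (3 * t).+1 i d 0).

(** Counting from zero, the vector with index i is supported at i and 3t - i. Comparing residues
    modulo 3 with that of [d] leaves the listed values of [k]. *)
Lemma cvec_mod0 : d = (3 * a)%N :> nat ->
  [/\ c (3 * k - 2) = 0, c (3 * k - 1) = 0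
    & c (3 * k) = (k == a)%:R + (k == (t - a)%N)%:R].
Proof.
move=> def_d; have lt_d : (d < 3 * t)%N := ltn_ord d; split.
- by rewrite (@cvec_entry _ _ _ false false) ?addr0 //; lia.
- by rewrite (@cvec_entry _ _ _ false false) ?addr0 //; lia.
- by apply: cvec_entry; lia.
Qed.

Lemma cvec_mod1 : d = (3 * a).+1 :> nat ->
  [/\ c (3 * k - 2) = (k == a.+1)%:R, c (3 * k - 1) = (k == (t - a)%N)%:R
    & c (3 * k) = 0].
Proof.
move=> def_d; have lt_d : (d < 3 * t)%N := ltn_ord d; split.
- by rewrite (@cvec_entry _ _ _ (k == a.+1) false) ?addr0 //; lia.
- by rewrite (@cvec_entry _ _ _ false (k == (t - a)%N)) ?add0r //; lia.
- by rewrite (@cvec_entry _ _ _ false false) ?addr0 //; lia.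
Qed.

Lemma cvec_mod2 : d = (3 * a).+2 :> nat ->
  [/\ c (3 * k - 2) = (k == (t - a)%N)%:R, c (3 * k - 1) = (k == a.+1)%:R
    & c (3 * k) = 0].
Proof.
move=> def_d; have lt_d : (d < 3 * t)%N := ltn_ord d; split.
- by rewrite (@cvec_entry _ _ _ false (k == (t - a)%N)) ?add0r //; lia.
- by rewrite (@cvec_entry _ _ _ (k == a.+1) false) ?addr0 //; lia.
- by rewrite (@cvec_entry _ _ _ false false) ?addr0 //; lia.
Qed.

End Cvec.

Lemma z1E n (d : 'I_n.-1) :
  z1 R n d 0 = (2 * n%:R - n%:R ^+ 2) * (d == 0 :> nat)%:R
    + \sum_(1 <= k < ((n - 4) %/ 6).+1)
        (zcoef1 R n k * cvec R n (3 * k - 2) d 0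
         - zcoef2 R n k * cvec R n (3 * k - 1) d 0 + cvec R n (3 * k) d 0)
    + cvec R n (n %/ 2 - 1) d 0.
Proof.
(* Abstracting [cvec] keeps [mxE] from expanding it. *)
rewrite /z1; move: (cvec R n) => c; rewrite !mxE summxE; congr (_ * _%:R + _ + _).
by apply: eq_bigr => k _; rewrite !mxE.
Qed.

Lemma z2E n (d : 'I_n.-1) :
  z2 R n d 0 = (2 * n%:R - n%:R ^+ 2) * (d == 0 :> nat)%:R
    + \sum_(1 <= k < ((n - 1) %/ 6).+1)
        (zcoef1 R n k * cvec R n (3 * k - 2) d 0
         - zcoef2 R n k * cvec R n (3 * k - 1) d 0)
    + \sum_(1 <= k < ((n - 7) %/ 6).+1) cvec R n (3 * k) d 0
    + (d.+1 == n.+1 %/ 2)%N%:R.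
Proof.
rewrite /z2; move: (cvec R n) => c; rewrite !mxE !summxE.
by congr (_ * _%:R + _ + _ + _%:R); apply: eq_bigr => k _; rewrite !mxE.
Qed.

(** Odd [t] means that n = 3t + 1 is even. At [d = 0] the coefficient is 2n - n^2 = 1 - (3t)^2;
    elsewhere, apart from the two middle positions, exactly one [k] of the sum contributes. *)
Lemma z1_entry t (d : 'I_(3 * t).+1.-1) : odd t ->
  z1 R (3 * t).+1 d 0 =
    1 - (3 * t)%:R ^+ 2 * (d == 0 :> nat)%:R - 3 / 2 * yrow (3 * t) d.
Proof.
move=> t_odd; have lt_d : (d < 3 * t)%N := ltn_ord d.
have [s eq_t] : exists s, t = (2 * s).+1 by exists t./2; lia.
rewrite z1E (_ : ((3 * t).+1 - 4) %/ 6 = s)%N; last by lia.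
rewrite (_ : (3 * t).+1 %/ 2 - 1 = (3 * s).+1)%N; last by lia.
(* The final vector fills the two middle positions, which the sum over [k <= s] does not reach. *)
rewrite (@cvec_entry _ _ _ (d == (3 * s).+1 :> nat) (d == (3 * s).+2 :> nat)); [|lia|lia].
rewrite big_nat; case def_d: _ / (mod3P d) => [a|a|a]; rewrite ?yrowE.
- under eq_bigr => k k_in.
    have [|-> -> ->] := @cvec_mod0 t k d a _ def_d; first by lia.
    (* The factors 1 bring the indicators to the shape required by [sum_delta]. *)
    rewrite !mulr0 subrr add0r -[(k == a)%:R]mul1r -[(k == _ - a)%N%:R]mul1r; over.
  rewrite -big_nat big_split /= !sum_delta; do !case: ifP => ?; do !case: eqP => ? /=;
    by [exfalso; lia | rewrite -natr1 !natrM; ring].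
- have le_at : (a <= t)%N by lia.
  under eq_bigr => k k_in.
    have [|-> -> ->] := @cvec_mod1 t k d a _ def_d; first by lia.
    rewrite addr0 -mulNr; over.
  rewrite -big_nat big_split /= !sum_delta /zcoef1 /zcoef2 (natrB _ le_at).
  rewrite -[a.+1%:R]natr1 -[(3 * t).+1%:R]natr1 !natrM.
  do !case: ifP => ?; do !case: eqP => ? /=; try (exfalso; lia); try by field.
  (* What remains is the middle position [d = 3 * s + 1], where [yrow] vanishes because
     [3 * t = 6 * s + 3]. *)
  have -> : a = s by lia.
  by rewrite eq_t -[(2 * s).+1%:R]natr1 natrM; field.
- have le_at : (a <= t)%N by lia.
  under eq_bigr => k k_in.
    have [|-> -> ->] := @cvec_mod2 t k d a _ def_d; first by lia.
    rewrite addr0 -mulNr; over.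
  rewrite -big_nat big_split /= !sum_delta /zcoef1 /zcoef2 (natrB _ le_at).
  rewrite -[a.+1%:R]natr1 -[(3 * t).+1%:R]natr1 !natrM.
  do !case: ifP => ?; do !case: eqP => ? /=; try (exfalso; lia); try by field.
  have -> : a = s by lia.
  by rewrite eq_t -[(2 * s).+1%:R]natr1 natrM; field.
Qed.

Lemma z2_entry t (d : 'I_(3 * t).+1.-1) : ~~ odd t ->
  z2 R (3 * t).+1 d 0 =
    1 - (3 * t)%:R ^+ 2 * (d == 0 :> nat)%:R - 3 / 2 * yrow (3 * t) d.
Proof.
move=> t_even; have lt_d : (d < 3 * t)%N := ltn_ord d.
have [s eq_t] : exists s, t = (2 * s)%N by exists t./2; lia.
rewrite z2E (_ : ((3 * t).+1 - 1) %/ 6 = s)%N; last by lia.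
(* Here [lt_d] forces [0 < s], so the subtraction is not truncated. The sum stops before [k = s],
   whose vector would count the middle position [3 * s] twice; the last basis vector supplies it
   once. *)
rewrite (_ : (((3 * t).+1 - 7) %/ 6).+1 = s)%N; last by lia.
rewrite (_ : (3 * t).+2 %/ 2 = (3 * s).+1)%N; last by lia.
rewrite big_nat [X in _ + X + _]big_nat.
case def_d: _ / (mod3P d) => [a|a|a]; rewrite ?yrowE.
- under eq_bigr => k k_in.
    have [|-> -> _] := @cvec_mod0 t k d a _ def_d; first by lia.
    rewrite !mulr0 subrr; over.
  under [X in _ + X + _]eq_bigr => k k_in.
    have [|_ _ ->] := @cvec_mod0 t k d a _ def_d; first by lia.
    rewrite -[(k == a)%:R]mul1r -[(k == _ - a)%N%:R]mul1r; over.
  rewrite big1 // -big_nat big_split /= !sum_delta.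
  do !case: ifP => ?; do !case: eqP => ? /=;
    by [exfalso; lia | rewrite -natr1 !natrM; ring].
- have le_at : (a <= t)%N by lia.
  under eq_bigr => k k_in.
    have [|-> -> _] := @cvec_mod1 t k d a _ def_d; first by lia.
    rewrite -mulNr; over.
  under [X in _ + X + _]eq_bigr => k k_in.
    have [|_ _ ->] := @cvec_mod1 t k d a _ def_d; first by lia.
    over.
  rewrite -big_nat [X in _ + X + _]big1 // big_split /= !sum_delta.
  rewrite /zcoef1 /zcoef2 (natrB _ le_at).
  rewrite -[a.+1%:R]natr1 -[(3 * t).+1%:R]natr1 !natrM.
  do !case: ifP => ?; do !case: eqP => ? /=; by [exfalso; lia | field].
- have le_at : (a <= t)%N by lia.
  under eq_bigr => k k_in.
    have [|-> -> _] := @cvec_mod2 t k d a _ def_d; first by lia.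
    rewrite -mulNr; over.
  under [X in _ + X + _]eq_bigr => k k_in.
    have [|_ _ ->] := @cvec_mod2 t k d a _ def_d; first by lia.
    over.
  rewrite -big_nat [X in _ + X + _]big1 // big_split /= !sum_delta.
  rewrite /zcoef1 /zcoef2 (natrB _ le_at).
  rewrite -[a.+1%:R]natr1 -[(3 * t).+1%:R]natr1 !natrM.
  do !case: ifP => ?; do !case: eqP => ? /=; by [exfalso; lia | field].
Qed.

End FirstRow.

(** * Products of the rim matrices B, J, K and Y, with M the rim length *)

Lemma mul_const_mx (R : pzSemiRingType) p q r (a b : R) :
  (const_mx a : 'M_(p, q)) *m (const_mx b : 'M_(q, r)) = const_mx (q%:R * (a * b)).
Proof.
apply/matrixP => i j; rewrite !mxE.
by under eq_bigr do rewrite !mxE; rewrite sumr_const card_ord mulr_natl.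
Qed.

Section RimMatrices.
Context {R : realType} {m t : nat}.
Hypothesis m_ge2 : (2 <= m)%N.
Hypothesis def_m : m.+2 = (3 * t)%N.
Local Notation M := (m.+2%:R : R).
Local Notation B := (@closed_nbhd_mx R m).
Local Notation J := (const_mx 1 : 'M[R]_m.+2).

Definition mod3_mx : 'M[R]_m.+2 := circulant (fun d => (3 %| d)%N%:R).
Definition yrow_mx : 'M[R]_m.+2 := circulant (fun d => yrow m.+2 d).
Local Notation K := mod3_mx.
Local Notation Y := yrow_mx.

Lemma val_ord_addr1 (d : 'I_m.+2) :
  d + 1 = (if d == m.+1 :> nat then 0 else d.+1)%N :> nat.
Proof.
rewrite -ordS_addr1 /=; case: eqVneq => [->|ne_d]; first exact: modnn.
by rewrite modn_small // ltn_neqAle eqSS ne_d ltn_ord.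
Qed.

Lemma val_ord_subr1 (d : 'I_m.+2) :
  d - 1 = (if d == 0 :> nat then m.+1 else d.-1)%N :> nat.
Proof.
rewrite -ord_pred_subr1 /=; case: eqVneq => [->|ne_d] /=; first by rewrite modn_small.
have lt_d := ltn_ord d.
by rewrite (_ : (d + m.+2).-1 = d.-1 + m.+2)%N ?modnDr ?modn_small; lia.
Qed.

Lemma mul_closed_nbhd f :
  B *m circulant f = circulant (fun d => f d + f (d - 1) + f (d + 1)).
Proof.
rewrite mul_circulant; apply/matrixP => i j; rewrite !mxE; move: (j - i) => d.
(* As 0, 1 and -1 are distinct, the convolution reduces to three terms. *)
have ne10 : 1 != 0 :> 'I_m.+2 by [].
have neN10 : -1 != 0 :> 'I_m.+2 by rewrite oppr_eq0.
have neN11 : -1 != 1 :> 'I_m.+2.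
  by rewrite -(inj_eq val_inj) val_ordrN1 /=; lia.
rewrite (bigD1 0) // (bigD1 1) //= (bigD1 (-1)) /= ?neN10 //.
rewrite big1 => [|k /andP[/andP[k0 k1] kN1]].
  by rewrite !eqxx (negPf neN11) (negPf neN10) /= !mul1r subr0 opprK addr0 !addrA.
by rewrite (negPf k0) (negPf k1) (negPf kN1) mul0r.
Qed.

Lemma const_mx_circulant : J = circulant (fun=> 1).
Proof. by apply/matrixP => i j; rewrite !mxE. Qed.

Lemma closed_nbhd_const p a : B *m const_mx a = const_mx (3 * a) :> 'M_(_, p).
Proof.
suff sumB : B *m J = const_mx 3.
  move: sumB; rewrite !mul_circulant_const => /matrixP/(_ 0 0).
  by rewrite !mxE mulr1 => ->.
rewrite {1}const_mx_circulant mul_closed_nbhd.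
by apply/matrixP => i j; rewrite !mxE; ring.
Qed.

(** Among three cyclically consecutive positions exactly one is a multiple of 3, even across the
    wrap-around, because 3 divides M. *)
Lemma mul_closed_nbhd_mod3 : B *m K = J.
Proof.
rewrite mul_closed_nbhd; apply/matrixP => i j; rewrite !mxE val_ord_addr1 val_ord_subr1.
have := ltn_ord (j - i); move: (val (j - i)) => d /= lt_d.
rewrite -!natrD (_ : (_ + _ + _)%N = 1%N) //; do 2!case: eqP => /= ?; lia.
Qed.

(** Comparing B K J with J J shows that three times the row sum of K is M, so no multiples have to
    be counted. *)
Lemma mod3_const p a : K *m const_mx a = const_mx (M / 3 * a) :> 'M_(_, p).
Proof.
rewrite mul_circulant_const; set sumK := \sum_d _.
have : B *m (K *m J) = J *m J by rewrite mulmxA mul_closed_nbhd_mod3.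
rewrite [K *m J]mul_circulant_const closed_nbhd_const {1}const_mx_circulant.
rewrite mul_circulant_const sumr_const card_ord => /matrixP/(_ 0 0).
rewrite !mxE -/sumK !mulr1 => sumK3; congr const_mx; congr (_ * _).
by rewrite -sumK3; field.
Qed.

(** Away from the wrap-around this is [yrow_nbhd]. At [d = 0] both neighbours, 1 and M - 1, carry 3
    - M, which produces the diagonal term. *)
Lemma mul_closed_nbhd_yrow : B *m Y = 6 *: K - (2 * M)%:M.
Proof.
rewrite mul_closed_nbhd; apply/matrixP => i j; rewrite !mxE val_ord_addr1 val_ord_subr1.
rewrite (_ : (i == j) = (j - i == 0 :> nat)); last by rewrite eq_sym -subr_eq0.
have := ltn_ord (j - i); move: (val (j - i)) => d /= lt_d.
have [a def_a] : exists a, t = a.+1 by case: t def_m => // a _; exists a.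
rewrite def_m in lt_d *.
case: eqP => [->|d_neq0]; last case: eqP => [|ne_d].
- rewrite /= (_ : m.+1 = (3 * a).+2); last by lia.
  by rewrite (yrow0 _ 0) (yrow1 _ 0) yrow2 def_a natrM -natr1; ring.
- move=> def_d; rewrite (yrow0 _ 0) def_d /= (_ : m.+1 = (3 * a).+2); last by lia.
  rewrite (_ : m = (3 * a).+1) ?yrow1 ?yrow2; last by lia.
  rewrite (_ : (3 %| (3 * a).+2)%N = false); last by lia.
  by rewrite /= mulr0n; ring.
- by rewrite yrow_nbhd ?mulr0n ?subr0 //; lia.
Qed.

(** Each entry is the sum of [yrow] over one residue class modulo 3. Reduction modulo M preserves
    these classes because 3 divides M. *)
Lemma mul_mod3_yrow : K *m Y = 0.
Proof.
rewrite mul_circulant; apply/matrixP => i j; rewrite !mxE; move: (j - i) => d.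
have sub_inj : injective (fun l => d - l) by move=> k l /addrI/oppr_inj.
rewrite (reindex_inj sub_inj).
transitivity (\sum_(l < m.+2) (l %% 3 == d %% 3)%N%:R * yrow m.+2 l : R).
  apply: eq_bigr => l _; rewrite subKr; congr (_%:R * _).
  have := ltn_ord l; rewrite /dvdn /= modnDmr => lt_l.
  rewrite modn_dvdm; first lia.
  by rewrite def_m dvdn_mulr.
rewrite -(big_mkord xpredT (fun l => (l %% 3 == d %% 3)%N%:R * yrow m.+2 l : R)).
by rewrite {1}def_m sum_yrow_class ?ltn_pmod // -natrM -def_m subrr mulr0 mul0r.
Qed.

(** From J Y = B K Y = 0 the first row of Y sums to zero. *)
Lemma yrow_const p a : Y *m const_mx a = 0 :> 'M_(_, p).
Proof.
have : J *m Y = 0 by rewrite -mul_closed_nbhd_mod3 -mulmxA mul_mod3_yrow mulmx0.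
rewrite const_mx_circulant mul_circulant => /matrixP/(_ 0 0); rewrite !mxE subrr.
rewrite (reindex_inj oppr_inj) => sumY; rewrite mul_circulant_const.
rewrite [X in X * a](_ : _ = 0) ?mul0r //.
by rewrite -[RHS]sumY; apply: eq_bigr => k _; rewrite mul1r sub0r opprK.
Qed.

Lemma trmx_closed_nbhd : B^T = B.
Proof.
apply: trmx_circulant => d; rewrite oppr_eq0 eqr_oppLR eqr_opp.
by case: (d == 0) => //=; rewrite orbC.
Qed.

Lemma val_ordN (d : 'I_m.+2) :
  - d = (if d == 0 :> nat then 0 else m.+2 - d)%N :> nat.
Proof.
rewrite /=; case: eqVneq => [->|ne_d]; first exact: modnn.
by rewrite modn_small // ltn_subrL lt0n ne_d.
Qed.

Lemma trmx_mod3 : K^T = K.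
Proof.
apply: trmx_circulant => d; rewrite val_ordN; case: eqVneq => [->//|_].
by congr _%:R; have := ltn_ord d; lia.
Qed.

Lemma trmx_yrow : Y^T = Y.
Proof.
apply: trmx_circulant => d; rewrite val_ordN; case: eqVneq => [->//|ne_d].
have := ltn_ord d; move: (val d) ne_d => {}d d_neq0 lt_d.
by rewrite def_m yrow_opp // lt0n d_neq0 -def_m ltnW.
Qed.

(** * The block matrices E, X and E X, and the Penrose equations *)

Definition wheel_ecc_mx : 'M[R]_(1 + m.+2) :=
  block_mx 0 (const_mx 1) (const_mx 1) (2 *: (J - B)).

Definition wheel_pinv_mx : 'M[R]_(1 + m.+2) :=
  block_mx (6 / M - 2)%:M (const_mx M^-1) (const_mx M^-1) ((4 * M)^-1 *: Y).

Definition wheel_proj_mx : 'M[R]_(1 + m.+2) :=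
  block_mx 1 0 0 (1%:M + M^-1 *: J - (3 / M) *: K).

Lemma natM_neq0 : M != 0. Proof. by rewrite pnatr_eq0. Qed.

Lemma trmx_wheel_ecc : wheel_ecc_mx^T = wheel_ecc_mx.
Proof.
by rewrite tr_block_mx trmx0 linearZ linearB /= trmx_closed_nbhd !trmx_const.
Qed.

Lemma trmx_wheel_pinv : wheel_pinv_mx^T = wheel_pinv_mx.
Proof.
by rewrite tr_block_mx linearZ /= trmx_yrow !trmx_const tr_scalar_mx.
Qed.

Lemma trmx_wheel_proj : wheel_proj_mx^T = wheel_proj_mx.
Proof.
rewrite tr_block_mx !trmx0 linearB linearD !linearZ /= trmx_mod3 trmx_const.
by rewrite !trmx1 scalerN.
Qed.

(** The corner of X is what makes the lower left block 6/M - 2 + 2(M - 3)/M vanish. As J Y = 0, the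
    lower right block is J/M - B Y/(2M), and B Y is known. *)
Lemma wheel_ecc_mul_pinv : wheel_ecc_mx *m wheel_pinv_mx = wheel_proj_mx.
Proof.
have M0 := natM_neq0.
rewrite mulmx_block; congr block_mx.
- rewrite mul0mx add0r mul_const_mx.
  by apply/matrixP => i j; rewrite !mxE (ord1 i) (ord1 j) mul1r mulfV.
- rewrite mul0mx add0r -[LHS]trmxK trmx_mul linearZ /= trmx_yrow trmx_const.
  by rewrite -scalemxAl yrow_const // scaler0 trmx0.
- rewrite -scalemxAl mulmxBl closed_nbhd_const // mul_const_mx mul_mx_scalar.
  by apply/matrixP => i j; rewrite !mxE; move: (m.+2%:R : R) M0 => x x0; field.
- rewrite mul_const_mx -scalemxAl -scalemxAr mulmxBl mul_closed_nbhd_yrow.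
  (* Transposition turns J Y into Y J, to which [yrow_const] applies. *)
  rewrite -[J]trmxK -[Y]trmxK -trmx_mul trmx_yrow trmx_const.
  rewrite yrow_const trmx0; apply/matrixP => i j; rewrite !mxE.
  by case: (i == j); rewrite ?mulr1n ?mulr0n; move: (m.+2%:R : R) M0 => x x0; field.
Qed.

(** The correction (J - 3K)/M annihilates e, J and B, since K J = (M/3) J, J B = 3J and K B = J. *)
Lemma wheel_proj_mul_ecc : wheel_proj_mx *m wheel_ecc_mx = wheel_ecc_mx.
Proof.
have M0 := natM_neq0.
have KB : K *m B = J.
  rewrite -[LHS]trmxK trmx_mul trmx_mod3 trmx_closed_nbhd.
  by rewrite mul_closed_nbhd_mod3 trmx_const.
have JB : J *m B = 3 *: J.
  rewrite -[LHS]trmxK trmx_mul trmx_closed_nbhd trmx_const closed_nbhd_const //.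
  by apply/matrixP => i j; rewrite !mxE.
rewrite mulmx_block !mul1mx !mul0mx !add0r !addr0; congr block_mx.
- rewrite mulmxBl mulmxDl mul1mx -!scalemxAl mod3_const mul_const_mx.
  by apply/matrixP => i j; rewrite !mxE; move: (m.+2%:R : R) M0 => x x0; field.
- rewrite -scalemxAr mulmxBr mulmxBl mulmxDl !mul1mx -!scalemxAl.
  rewrite mod3_const mul_const_mx mulmxBl mulmxDl mul1mx -!scalemxAl KB JB.
  by apply/matrixP => i j; rewrite !mxE; move: (m.+2%:R : R) M0 => x x0; field.
Qed.

(** The same correction annihilates Y, since J Y = K Y = 0. *)
Lemma wheel_proj_mul_pinv : wheel_proj_mx *m wheel_pinv_mx = wheel_pinv_mx.
Proof.
have M0 := natM_neq0.
have JY : J *m Y = 0.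
  rewrite -[LHS]trmxK trmx_mul trmx_yrow trmx_const.
  by rewrite yrow_const trmx0.
rewrite mulmx_block !mul1mx !mul0mx !add0r !addr0; congr block_mx.
- rewrite mulmxBl mulmxDl mul1mx -!scalemxAl mod3_const mul_const_mx.
  by apply/matrixP => i j; rewrite !mxE; move: (m.+2%:R : R) M0 => x x0; field.
- rewrite -scalemxAr mulmxBl mulmxDl mul1mx -!scalemxAl mul_mod3_yrow JY.
  by rewrite !scaler0 addr0 subr0.
Qed.

(** E, X and E X are symmetric, so X E = (E X)' = E X, and one projection serves all four
    equations. *)
Lemma penrose_wheel : penrose wheel_ecc_mx wheel_pinv_mx.
Proof.
have pinv_mul_ecc : wheel_pinv_mx *m wheel_ecc_mx = wheel_proj_mx.
  rewrite -[LHS]trmxK trmx_mul trmx_wheel_ecc trmx_wheel_pinv wheel_ecc_mul_pinv.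
  exact: trmx_wheel_proj.
apply/and4P; split; apply/eqP; rewrite ?wheel_ecc_mul_pinv ?pinv_mul_ecc.
- exact: wheel_proj_mul_ecc.
- exact: wheel_proj_mul_pinv.
- exact: trmx_wheel_proj.
- exact: trmx_wheel_proj.
Qed.

End RimMatrices.

(** * Identification of the stated formula with X *)

Lemma zvec_entry (R : realType) n t (d : 'I_n.-1) : n = (3 * t).+1 ->
  (if odd n then z2 R n else z1 R n) d 0 =
    1 - n.-1%:R ^+ 2 * (d == 0 :> nat)%:R - 3 / 2 * yrow n.-1 d.
Proof.
move=> def_n; rewrite {n}def_n in d *; rewrite /= oddM /=.
by case: ifPn => [/z2_entry|/negPn/z1_entry].
Qed.

Lemma wheel_pinv_formula (R : realType) m t : m.+2 = (3 * t)%N ->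
  - (1 / 2) *: Lhat R m.+3
    + (6 / (m.+3%:R - 1)) *: (wvec R m.+3 *m (wvec R m.+3)^T) = wheel_pinv_mx.
Proof.
move=> def_m; have M0 : m.+2%:R != 0 :> R by rewrite pnatr_eq0.
have n1E : m.+3%:R = m.+2%:R + 1 :> R by rewrite natr1.
rewrite /Lhat /wvec /Pmx (scalar_mx_block 1 m.+2) Circ_circulant.
rewrite [(_ *: col_mx _ _)^T]linearZ /= -scalemxAl -scalemxAr tr_col_mx.
rewrite mul_col_row !trmx_const !mul_const_mx.
rewrite !(scale_block_mx, add_block_mx, opp_block_mx); congr block_mx.
- apply/matrixP => i j; rewrite !mxE (ord1 i) (ord1 j) n1E addrK !eqxx !mulr1n.
  by move: (m.+2%:R : R) M0 => x x0; field.
- apply/matrixP => i j; rewrite !mxE n1E addrK.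
  by move: (m.+2%:R : R) M0 => x x0; field.
- apply/matrixP => i j; rewrite !mxE n1E addrK.
  by move: (m.+2%:R : R) M0 => x x0; field.
(* In the rim block the identity summand of [Lhat] cancels the -M^2 of the first row of P, and w w'
   cancels its constant 1, leaving Y/(4M). *)
apply/matrixP => i j; have := @zvec_entry R m.+3 t (j - i) (congr1 S def_m).
rewrite /=; move: (if _ then _ else _) => z z_entry.
rewrite !mxE z_entry n1E addrK (_ : (i == j) = (j - i == 0 :> nat)); last first.
  by rewrite eq_sym -subr_eq0.
move: (m.+2%:R : R) (yrow _ _ : R) M0 => x y x0.
by case: (_ == 0 :> nat); rewrite ?mulr1n ?mulr0n; field.
Qed.

Theorem theorem6p10 (R : realType) (n : nat)
    (n_ge10 : (10 <= n)%N) (n_mod3 : n = 1 %[mod 3]) :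
  mpinv (ecc_mx R (wheel n)) =
    - (1 / 2) *: Lhat R n + (6 / (n%:R - 1)) *: (wvec R n *m (wvec R n)^T).
Proof.
case: n n_ge10 n_mod3 => [|[|[|m]]] // m_ge7 n_mod3.
have m_ge2 : (2 <= m)%N by lia.
have [t def_m] : exists t, m.+2 = (3 * t)%N by exists (m.+2 %/ 3)%N; lia.
apply: mpinv_eq; rewrite (wheel_pinv_formula _ _ _ def_m) ecc_mx_wheel //.
exact: penrose_wheel m_ge2 def_m.
Qed.
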